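(* Let $$M=\begin{bmatrix} A & B \\ C & D \end{bmatrix}$$ be a nonsingular $2\times 2$ square block matrix, and consider the problem of finding a lower triangular $L$ and an upper triangular $U$ with $$M=LU,\qquad L=\begin{bmatrix} L_1 & 0 \\ X & L_2 \end{bmatrix},\qquad U=\begin{bmatrix} U_1 & Y \\ 0 & U_2 \end{bmatrix},$$ where $L_1,L_2$ are lower triangular and $U_1,U_2$ are upper triangular. The four components of $M=LU$ are $$A=L_1U_1,\qquad B=L_1Y,\qquad C=XU_1,\qquad D=L_2U_2+XY.$$ Assuming $A$ is nonsingular, these give two recursive LU decompositions, $A=L_1U_1$ and $L_2U_2=D-XY$, in which case $X$ and $Y$ may be obtained as $X=CU_1^{-1}$ and $Y=L_1^{-1}B$; if $A$ is nonsingular, so are $L_1$ and $U_1$. Thus the matrices $L_i,U_i,X,Y$ may be computed, in this order, from $$L_1U_1=A,\qquad X=CU_1^{-1},\qquad Y=L_1^{-1}B,\qquad L_2U_2=D-XY,$$ where the first and last lines are recursive LU decompositions. The degree of freedom in choosing the diagonal elements of $L$ and $U$ is handled by taking the same convention in the recursive computations of $L_1U_1$ and $L_2U_2$.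
   Context: An LU decomposition of a square matrix is a factorization as a lower triangular matrix $L$ times an upper triangular matrix $U$. The blocks $A,B,C,D$ are square and of equal size. It is assumed that one of the blocks is nonsingular and that block rows and columns have been permuted as necessary so that the $(1,1)$ block $A$ is nonsingular. Such permutations, also when needed at recursive steps, are multiplied onto the matrix on the left and right, and are suppressed from the notation; with them restored, the factorization of the original matrix has the form $PLUQ$ with permutation matrices $P,Q$. *)

(* Defs.v *)
From HB Require Import structures.
From mathcomp Require Import all_boot all_order all_algebra.
Set Implicit Arguments.
Unset Strict Implicit.
Unset Printing Implicit Defensive.
Import GRing.Theory.
Local Open Scope ring_scope.

(* [is_trig_mx] means lower triangular; upper triangularity is stated on the
   transpose. *)
Definition is_upper_mx (F : fieldType) (n : nat) (U : 'M[F]_n) : bool :=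
  is_trig_mx U^T.

Definition LU_decomposition (F : fieldType) (n : nat) (M L U : 'M[F]_n) : Prop :=
  [/\ M = L *m U, is_trig_mx L & is_upper_mx U].

(* In M = LU only the product of the i-th diagonal entries of L and U (the i-th
   pivot) is constrained. A convention is a rule [split] distributing a nonzero
   pivot p over the two factors, e.g. p |-> (1, p) for unit lower triangular L,
   or p |-> (p, 1) for unit upper triangular U. *)
Definition diagonal_convention (F : fieldType) (split : F -> F * F) : Prop :=
  forall p : F, p != 0 -> (split p).1 * (split p).2 = p.

Definition follows_convention (F : fieldType) (split : F -> F * F)
    (n : nat) (L U : 'M[F]_n) : Prop :=
  forall i : 'I_n, (L i i, U i i) = split (L i i * U i i).

(* Exchange of the two block rows (acting on the left) or of the two block
   columns (acting on the right) if [b], and the identity otherwise. *)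
Definition block_swap (F : fieldType) (n : nat) (b : bool) : 'M[F]_(n + n) :=
  if b then block_mx 0 1%:M 1%:M 0 else 1%:M.

(* [block_pivotable M]: at every step of the recursion, down to 1 x 1 matrices,
   some block is nonsingular and, once it has been moved to position (1,1) by
   block swaps, the recursion can continue on it and on its Schur complement. *)
Inductive block_pivotable (F : fieldType) : forall n : nat, 'M[F]_n -> Prop :=
| BlockPivotable1 (a : F) of a != 0 : block_pivotable (a%:M : 'M[F]_1)
| BlockPivotable2 (n : nat) (r c : bool) (A B C D : 'M[F]_n) of
    A \in unitmx &
    block_pivotable A &
    block_pivotable (D - C *m invmx A *m B) :
    block_pivotable
      (block_swap F n r *m block_mx A B C D *m block_swap F n c).

(* [recursive_LU split M P L U Q]: the recursive block algorithm, run on M, can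
   return M = P L U Q. With A = P1 (L1 U1) Q1 and D - X0 Y0 = P2 (L2 U2) Q2
   returned by the recursive calls, the permuted matrix
     diag(P1, P2)^-1 [A B; C D] diag(Q1, Q2)^-1 = [A' B'; C' D']
   satisfies L1 U1 = A', X = C' U1^-1, Y = L1^-1 B', L2 U2 = D' - X Y for
   X = P2^-1 X0 and Y = Y0 Q2^-1. As P2 and Q2 are only known after the second
   call, they are applied to X0 and Y0 afterwards. *)
Inductive recursive_LU (F : fieldType) (split : F -> F * F) :
    forall n : nat, 'M[F]_n -> 'M[F]_n -> 'M[F]_n -> 'M[F]_n -> 'M[F]_n -> Prop :=
| RecursiveLU1 (a : F) of a != 0 :
    recursive_LU split (a%:M : 'M[F]_1)
      1%:M (split a).1%:M (split a).2%:M 1%:M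
| RecursiveLU2 (n : nat) (r c : bool) (A B C D : 'M[F]_n)
    (P1 L1 U1 Q1 X0 Y0 P2 L2 U2 Q2 : 'M[F]_n) of
    A \in unitmx &
    recursive_LU split A P1 L1 U1 Q1 &
    X0 = C *m invmx Q1 *m invmx U1 &
    Y0 = invmx L1 *m (invmx P1 *m B) &
    recursive_LU split (D - X0 *m Y0) P2 L2 U2 Q2 :
    recursive_LU split
      (block_swap F n r *m block_mx A B C D *m block_swap F n c)
      (block_swap F n r *m block_mx P1 0 0 P2)
      (block_mx L1 0 (invmx P2 *m X0) L2)
      (block_mx U1 (Y0 *m invmx Q2) 0 U2)
      (block_mx Q1 0 0 Q2 *m block_swap F n c).

(* Main.v *)
Require Import Defs.
From HB Require Import structures.
From mathcomp Require Import all_boot all_order all_fingroup all_algebra.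
Set Implicit Arguments.
Unset Strict Implicit.
Unset Printing Implicit Defensive.
Import GRing.Theory.
Local Open Scope ring_scope.

(** Comparing blocks in M = LU shows that, for A nonsingular, LU decompositions
    of M are pairs of LU decompositions of A and of its Schur complement
    D - XY. Applied to blocks of sizes 1 and n, this gives by induction the
    uniqueness of the factors under a diagonal convention: the 1 x 1 block fixes
    the first pivot, hence, by the convention, the first diagonal entries. In
    the pivoted recursion, A = P1 L1 U1 Q1 gives X0 Y0 = C A^-1 B, so that the
    second recursive call is made on the Schur complement of A whatever
    permutations were chosen in the first one. *)

(** * Block triangular factors and the Schur complement *)

Section TriangularBlocks.
Variables (F : fieldType) (m n : nat).

Lemma lower_blockP (L : 'M[F]_(m + n)) :
  is_trig_mx L <->
  exists (L1 : 'M_m) (X : 'M_(n, m)) (L2 : 'M_n),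
    [/\ L = block_mx L1 0 X L2, is_trig_mx L1 & is_trig_mx L2].
Proof.
split=> [|[L1 [X [L2 [-> L1l L2l]]]]]; last by rewrite is_trig_block_mx ?eqxx ?L1l.
rewrite -{1}[L]submxK is_trig_block_mx // => /and3P[/eqP L0 L1l L2l].
exists (ulsubmx L), (dlsubmx L), (drsubmx L); split=> //.
by rewrite -{1}[L]submxK L0.
Qed.

Lemma upper_blockP (U : 'M[F]_(m + n)) :
  is_upper_mx U <->
  exists (U1 : 'M_m) (Y : 'M_(m, n)) (U2 : 'M_n),
    [/\ U = block_mx U1 Y 0 U2, is_upper_mx U1 & is_upper_mx U2].
Proof.
apply: (iff_trans (lower_blockP U^T)).
split=> -[U1 [Y [U2 [defU U1u U2u]]]]; exists U1^T, Y^T, U2^T.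
  by split; rewrite /is_upper_mx ?trmxK // -[U]trmxK defU tr_block_mx trmx0.
by rewrite defU tr_block_mx trmx0.
Qed.

Lemma lower_block_mx (L1 : 'M[F]_m) X (L2 : 'M_n) :
  is_trig_mx (block_mx L1 0 X L2) = is_trig_mx L1 && is_trig_mx L2.
Proof. by rewrite is_trig_block_mx // eqxx. Qed.

Lemma upper_block_mx (U1 : 'M[F]_m) Y (U2 : 'M_n) :
  is_upper_mx (block_mx U1 Y 0 U2) = is_upper_mx U1 && is_upper_mx U2.
Proof. by rewrite /is_upper_mx tr_block_mx trmx0 lower_block_mx. Qed.

Lemma unitmx_lblock (L1 : 'M[F]_m) X (L2 : 'M_n) :
  (block_mx L1 0 X L2 \in unitmx) = (L1 \in unitmx) && (L2 \in unitmx).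
Proof. by rewrite !unitmxE det_lblock unitrM. Qed.

Lemma unitmx_ublock (U1 : 'M[F]_m) Y (U2 : 'M_n) :
  (block_mx U1 Y 0 U2 \in unitmx) = (U1 \in unitmx) && (U2 \in unitmx).
Proof. by rewrite !unitmxE det_ublock unitrM. Qed.

Lemma mul_lower_upper_blockP (A : 'M[F]_m) B C (D : 'M_n)
    (L1 : 'M_m) X (L2 : 'M_n) (U1 : 'M_m) Y (U2 : 'M_n) :
  block_mx A B C D = block_mx L1 0 X L2 *m block_mx U1 Y 0 U2 <->
  [/\ A = L1 *m U1, B = L1 *m Y, C = X *m U1 & D = L2 *m U2 + X *m Y].
Proof.
rewrite mulmx_block !mul0mx !mulmx0 !addr0 [X *m Y + _]addrC.
by split=> [/eq_block_mx //|[-> -> -> ->]].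
Qed.

Lemma follows_convention_block split (L1 : 'M[F]_m) X (L2 : 'M_n) U1 Y U2 :
  follows_convention split (block_mx L1 0 X L2) (block_mx U1 Y 0 U2) <->
  follows_convention split L1 U1 /\ follows_convention split L2 U2.
Proof.
split=> [LUs|[LUs1 LUs2] i].
  split=> i; first by have:= LUs (lshift n i); rewrite !block_mxEul.
  by have:= LUs (rshift m i); rewrite !block_mxEdr.
by case: (split_ordP i) => j ->; rewrite ?block_mxEul ?block_mxEdr.
Qed.

Lemma block_LUP (A : 'M[F]_m) B C (D : 'M_n) L1 X L2 U1 Y U2 :
  A \in unitmx ->
  LU_decomposition (block_mx A B C D)
    (block_mx L1 0 X L2) (block_mx U1 Y 0 U2) <->
  [/\ LU_decomposition A L1 U1,
      X = C *m invmx U1,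
      Y = invmx L1 *m B &
      LU_decomposition (D - X *m Y) L2 U2].
Proof.
move=> Aunit; rewrite /LU_decomposition lower_block_mx upper_block_mx.
split=> [[/mul_lower_upper_blockP[defA -> -> ->]]|].
  move=> /andP[L1l L2l] /andP[U1u U2u]; move: Aunit.
  (* A nonsingular product [L1 *m U1] has both factors nonsingular, so the equations for [B] and [C]
     can be solved uniquely for [Y] and [X]. *)
  rewrite defA unitmx_mul => /andP[L1unit U1unit].
  by rewrite mulmxK ?mulKmx ?addrK.
case=> -[defA L1l U1u] -> -> [defS L2l U2u]; move: Aunit.
rewrite defA unitmx_mul => /andP[L1unit U1unit].
rewrite L1l L2l U1u U2u; split=> //.
by apply/mul_lower_upper_blockP; rewrite mulmxKV ?mulKVmx // -defS subrK.
Qed.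

(** The matrix factors as a block lower triangular one with diagonal blocks [L1], [1%:M] times a
    block upper triangular one with diagonal blocks [U1] and the Schur complement; nonsingularity of
    the product passes to every diagonal block. *)
Lemma unitmx_Schur (A : 'M[F]_m) B C (D : 'M_n) (L1 U1 : 'M_m) :
  A \in unitmx -> block_mx A B C D \in unitmx -> A = L1 *m U1 ->
  [/\ L1 \in unitmx, U1 \in unitmx &
      D - (C *m invmx U1) *m (invmx L1 *m B) \in unitmx].
Proof.
move=> + + defA; rewrite {1}defA unitmx_mul => /andP[L1unit U1unit].
have /mul_lower_upper_blockP -> : [/\ A = L1 *m U1, B = L1 *m (invmx L1 *m B),
    C = (C *m invmx U1) *m U1 &
    D = 1%:M *m (D - (C *m invmx U1) *m (invmx L1 *m B))
        + (C *m invmx U1) *m (invmx L1 *m B)].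
  by rewrite mulmxKV // mulKVmx // mul1mx subrK.
by rewrite unitmx_mul unitmx_ublock => /and3P[].
Qed.

(** * Permutation matrices assembled from blocks *)

Lemma bij_sum_perm_mx (g : 'I_m + 'I_n -> 'I_m + 'I_n) :
  injective g ->
  is_perm_mx (\matrix_(i, j) (g (split i) == split j)%:R : 'M[F]_(m + n)).
Proof.
(* Conjugation by [split] and [unsplit] turns [g] into a permutation of the indices below [m + n].
   Block diagonal permutations and block swaps both arise from such a [g]. *)
move=> g_inj; have f_inj : injective (fun i => unsplit (g (split i))).
  apply: inj_comp; first exact: can_inj unsplitK.
  by apply: inj_comp => //; apply: can_inj splitK.
apply/is_perm_mxP; exists (perm f_inj); apply/matrixP=> i j.
by rewrite !mxE permE -(can_eq unsplitK) splitK.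
Qed.

Lemma is_perm_diag_block (P1 : 'M[F]_m) (P2 : 'M_n) :
  is_perm_mx P1 -> is_perm_mx P2 -> is_perm_mx (block_mx P1 0 0 P2).
Proof.
case/is_perm_mxP=> s -> /is_perm_mxP[t ->].
pose g (u : 'I_m + 'I_n) : 'I_m + 'I_n :=
  match u with inl i => inl (s i) | inr i => inr (t i) end.
have g_inj : injective g by move=> [i|i] [j|j] // [/perm_inj->].
rewrite (_ : block_mx _ _ _ _ = \matrix_(i, j) (g (split i) == split j)%:R).
  exact: bij_sum_perm_mx.
by apply/matrixP=> i j; rewrite !mxE; case: split => i'; rewrite mxE;
  case: split=> j'; rewrite !mxE.
Qed.

End TriangularBlocks.

Lemma is_perm_block_swap (F : fieldType) n b : is_perm_mx (block_swap F n b).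
Proof.
case: b; last exact: is_perm_mx1.
pose g (u : 'I_n + 'I_n) : 'I_n + 'I_n :=
  match u with inl i => inr i | inr i => inl i end.
have g_inj : injective g by move=> [i|i] [j|j] // [->].
rewrite (_ : block_swap F n true = \matrix_(i, j) (g (split i) == split j)%:R).
  exact: bij_sum_perm_mx.
by apply/matrixP=> i j; rewrite !mxE; case: split => i'; rewrite mxE;
  case: split=> j'; rewrite !mxE.
Qed.

Lemma is_perm_mx_unit (F : fieldType) n (P : 'M[F]_n) :
  is_perm_mx P -> P \in unitmx.
Proof. by case/is_perm_mxP=> s ->; apply: unitmx_perm. Qed.

(** * Uniqueness under a diagonal convention *)

Lemma LU_convention_uniq (F : fieldType) (split : F -> F * F) n
    (M L U L' U' : 'M[F]_n) :
  M \in unitmx ->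
  LU_decomposition M L U -> follows_convention split L U ->
  LU_decomposition M L' U' -> follows_convention split L' U' ->
  L = L' /\ U = U'.
Proof.
elim: n => [|n IHn] in M L U L' U' *.
  by move=> *; rewrite [L]flatmx0 [L']flatmx0 [U]flatmx0 [U']flatmx0.
rewrite -[n.+1]/(1 + n)%N in M L U L' U' * => Munit LU LUs LU' LUs'.
have [_ /lower_blockP[l [x [L2 [defL _ _]]]]
  /upper_blockP[u [y [U2 [defU _ _]]]]] := LU.
have [_ /lower_blockP[l' [x' [L2' [defL' _ _]]]]
  /upper_blockP[u' [y' [U2' [defU' _ _]]]]] := LU'.
(* The first pivot is nonzero because a decomposition exists: nonsingular [M] makes [L] and [U]
   nonsingular, hence also [l] and [u], whose product is the leading entry. *)
have Aunit : ulsubmx M \in unitmx.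
  case: LU Munit => -> _ _; rewrite unitmx_mul defL defU
    unitmx_lblock unitmx_ublock.
  case/andP=> /andP[lunit _] /andP[uunit _].
  by rewrite mulmx_block block_mxKul mul0mx addr0 unitmx_mul lunit.
move: Munit LU LUs LU' LUs'; rewrite {}defL {}defU {}defL' {}defU'.
rewrite -[M]submxK => Munit.
move=> /(block_LUP _ _ _ _ _ _ _ _ _ Aunit)[[defA _ _] -> -> LU2].
move=> /follows_convention_block[lus LUs2].
move=> /(block_LUP _ _ _ _ _ _ _ _ _ Aunit)[[defA' _ _] -> -> LU2'].
move=> /follows_convention_block[lus' LUs2'].
have [ll uu] : l = l' /\ u = u'.
  have /matrixP/(_ 0 0) : l *m u = l' *m u' by rewrite -defA.
  rewrite !mxE !big_ord1 => pivot.
  have := lus 0; rewrite pivot -lus' => -[l00 u00].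
  by split; apply/matrixP=> i j; rewrite !ord1.
(* Once [l = l'] and [u = u'], the trailing blocks decompose one and the same Schur complement,
   which inherits nonsingularity from [M]. *)
have [_ _ Sunit] := unitmx_Schur Aunit Munit defA.
case: ll uu LU2' => <- <- LU2'.
by have [-> ->] := IHn _ _ _ _ _ Sunit LU2 LUs2 LU2' LUs2'.
Qed.

(** * Correctness and existence of runs of the pivoted recursion *)

Lemma recursive_LU_sound (F : fieldType) (split : F -> F * F) n
    (M P L U Q : 'M[F]_n) :
  diagonal_convention split -> recursive_LU split M P L U Q ->
  [/\ is_perm_mx P, is_perm_mx Q, is_trig_mx L & is_upper_mx U] /\
  follows_convention split L U /\ M = P *m L *m U *m Q.
Proof.
move=> hsplit; elim=> {n M P L U Q} [a a0|].
  split; first by rewrite is_perm_mx1 /is_upper_mx !mx11_is_trig.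
  split; last by rewrite mul1mx mulmx1 -scalar_mxM hsplit.
  (* As [a] is nonzero, the two diagonal entries multiply back to [a], and [split] returns them
     again. *)
  by move=> i; rewrite !mxE eqxx !mulr1n hsplit //; case: (split a).
move=> n r c A B C D P1 L1 U1 Q1 X0 Y0 P2 L2 U2 Q2 Aunit _.
move=> [[P1p Q1p L1l U1u] [LUs1 defA]] defX defY _.
move=> [[P2p Q2p L2l U2u] [LUs2 defS]].
have [P2unit Q2unit] := (is_perm_mx_unit P2p, is_perm_mx_unit Q2p).
(* [invmx] fixes singular matrices, so [X0] and [Y0] solve their equations only once the factors of
   [A] are known to be nonsingular. *)
have := Aunit; rewrite {1}defA !unitmx_mul -!andbA
  => /and4P[P1unit L1unit U1unit Q1unit].
split; [split | split].
- by rewrite is_perm_mxMr ?is_perm_diag_block // is_perm_block_swap.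
- by rewrite is_perm_mxMl ?is_perm_diag_block // is_perm_block_swap.
- by rewrite lower_block_mx L1l.
- by rewrite upper_block_mx U1u.
- exact/follows_convention_block.
rewrite -!mulmxA; congr (_ *m _); rewrite !mulmxA; congr (_ *m _).
(* With the outer swaps stripped, [P2] and [Q2] cancel the inverses stored in the off-diagonal
   blocks, and the last block becomes [X0 *m Y0] plus the Schur complement, that is [D]. *)
rewrite !mulmx_block !(mul0mx, mulmx0, addr0, add0r) mulKVmx //.
rewrite mulmxDl !mulmxA !mulmxKV // -defA -defS addrC subrK; congr block_mx.
  by rewrite defY -[P1 *m L1 *m _]mulmxA mulKVmx // mulKVmx.
by rewrite defX !mulmxKV.
Qed.

Lemma recursive_LU_exists (F : fieldType) (split : F -> F * F) n (M : 'M[F]_n) :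
  diagonal_convention split -> block_pivotable M ->
  exists P L U Q, recursive_LU split M P L U Q.
Proof.
move=> hsplit; elim=> {n M} [a a0|n r c A B C D Aunit _ [P1 [L1 [U1 [Q1 run1]]]] _].
  by do 4!eexists; apply: RecursiveLU1.
(* Pivotability speaks of [invmx A], the second call of [X0 *m Y0]. Correctness of the first run
   factors [A], and inverting that factorization identifies the two. *)
have [_ [_ defA]] := recursive_LU_sound hsplit run1.
have := Aunit; rewrite {1}defA !unitmx_mul -!andbA
  => /and4P[P1u L1u U1u Q1u].
have -> : C *m invmx A *m B
    = (C *m invmx Q1 *m invmx U1) *m (invmx L1 *m (invmx P1 *m B)).
  have -> : invmx A = invmx Q1 *m invmx U1 *m invmx L1 *m invmx P1.
    apply: (can_inj (mulmxK Aunit)); rewrite mulVmx // {1}defA !mulmxA.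
    by rewrite mulmxKV // mulmxKV // mulmxKV // mulVmx.
  by rewrite !mulmxA.
case=> [P2 [L2 [U2 [Q2 run2]]]].
by do 4!eexists; apply: RecursiveLU2 Aunit run1 erefl erefl run2.
Qed.

Theorem mainTheorem1 (F : fieldType) (split : F -> F * F)
    (hsplit : diagonal_convention split)
    (n : nat) (A B C D : 'M[F]_n)
    (hM : block_mx A B C D \in unitmx) :
  (* block form of the triangular factors *)
  ((forall L : 'M[F]_(n + n),
      is_trig_mx L <->
      exists L1 X L2 : 'M[F]_n,
        [/\ L = block_mx L1 0 X L2, is_trig_mx L1 & is_trig_mx L2])
   /\
   (forall U : 'M[F]_(n + n),
      is_upper_mx U <->
      exists U1 Y U2 : 'M[F]_n,
        [/\ U = block_mx U1 Y 0 U2, is_upper_mx U1 & is_upper_mx U2]))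
  /\
  (* the four components of M = LU *)
  (forall L1 X L2 U1 Y U2 : 'M[F]_n,
     block_mx A B C D = block_mx L1 0 X L2 *m block_mx U1 Y 0 U2 <->
     [/\ A = L1 *m U1, B = L1 *m Y, C = X *m U1 & D = L2 *m U2 + X *m Y])
  /\
  (* block LU decomposition when A is nonsingular *)
  (A \in unitmx ->
   (forall L1 U1 : 'M[F]_n,
      LU_decomposition A L1 U1 ->
      [/\ L1 \in unitmx, U1 \in unitmx &
          D - (C *m invmx U1) *m (invmx L1 *m B) \in unitmx])
   /\
   (forall L1 X L2 U1 Y U2 : 'M[F]_n,
      LU_decomposition (block_mx A B C D)
        (block_mx L1 0 X L2) (block_mx U1 Y 0 U2) <->
      [/\ LU_decomposition A L1 U1,
          X = C *m invmx U1,
          Y = invmx L1 *m B &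
          LU_decomposition (D - X *m Y) L2 U2]))
  /\
  (* the same diagonal convention in both recursive computations *)
  ((forall L1 X L2 U1 Y U2 : 'M[F]_n,
      follows_convention split (block_mx L1 0 X L2) (block_mx U1 Y 0 U2) <->
      follows_convention split L1 U1 /\ follows_convention split L2 U2)
   /\
   (forall L U L' U' : 'M[F]_(n + n),
      LU_decomposition (block_mx A B C D) L U ->
      follows_convention split L U ->
      LU_decomposition (block_mx A B C D) L' U' ->
      follows_convention split L' U' ->
      L = L' /\ U = U'))
  /\
  (* the full recursion, with the permutations restored *)
  ((block_pivotable (block_mx A B C D) ->
    exists P L U Q : 'M[F]_(n + n),
      recursive_LU split (block_mx A B C D) P L U Q)
   /\
   (forall P L U Q : 'M[F]_(n + n),
      recursive_LU split (block_mx A B C D) P L U Q ->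
      [/\ is_perm_mx P, is_perm_mx Q, is_trig_mx L & is_upper_mx U] /\
      follows_convention split L U /\
      block_mx A B C D = P *m L *m U *m Q)).
Proof.
split; first by split; [apply: lower_blockP | apply: upper_blockP].
split; first by move=> *; apply: mul_lower_upper_blockP.
split.
  move=> Aunit; split=> [L1 U1 [defA _ _] | *]; first exact: (unitmx_Schur Aunit hM defA).
  exact: block_LUP.
split.
  split=> [*|L U L' U' LU LUs LU' LUs']; first exact: follows_convention_block.
  exact: LU_convention_uniq hM LU LUs LU' LUs'.
split; first exact: recursive_LU_exists.
by move=> *; apply: recursive_LU_sound.
Qed.
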